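(* Let $A \subset C(X)$ be a uniform algebra, let $\theta : A \to M_n(\mathbb{C})$ be a continuous unital homomorphism, and let $\alpha : A \to A$ be an antilinear contraction. Define a linear map $\theta_\alpha : A \to M_n(\mathbb{C})$ by $$\theta_\alpha(f) := \tfrac12\bigl(\theta(f) + \theta(\alpha(f))^*\bigr)\quad (f \in A).$$ If $\|\theta_\alpha\| \le 1$, then $\|\theta\| \le 1+\sqrt2$. Moreover, the constant $1+\sqrt2$ is sharp: it cannot be replaced by any smaller constant in this statement (valid for all uniform algebras $A$, all $n$, all such $\theta$ and $\alpha$).
   Context: A uniform algebra is a norm-closed subalgebra $A$ of $C(X)$, for $X$ a compact Hausdorff space, that contains the constant functions. It carries the supremum norm. $M_n(\mathbb{C})$ carries the operator norm, and $\|\cdot\|$ of a linear map is its operator norm. Homomorphisms are unital. A map $\alpha$ is antilinear if $\alpha(\lambda f + g) = \overline{\lambda}\alpha(f) + \alpha(g)$. It is a contraction if $\|\alpha(f)\| \le \|f\|$ for all $f$. *)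

(* Defs.v *)
(* MathComp + MathComp-Analysis, complex numbers R[i] from
   mathcomp-real-closed over an arbitrary R : realType. *)
From HB Require Import structures.
From mathcomp Require Import all_boot all_order all_algebra.
From mathcomp Require Import complex.
From mathcomp Require Import all_classical all_reals all_analysis.
Set Implicit Arguments. Unset Strict Implicit. Unset Printing Implicit Defensive.
Import Order.TTheory GRing.Theory Num.Theory.
Local Open Scope ring_scope.
Local Open Scope classical_set_scope.

Section UniformAlgebras.
Variable R : realType.
Local Notation C := (R[i]).

(** Modulus of a complex number (real-valued). *)
Definition cabs (z : C) : R := Num.sqrt (complex.Re z ^+ 2 + complex.Im z ^+ 2).

Variable X : topologicalType.

(** Continuity of a complex-valued function on X (standard metric on C). *)
Definition ccontinuous (f : X -> C) : Prop :=
  forall x (e : R), 0 < e -> \forall y \near x, cabs (f y - f x) < e.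

(** Supremum norm of a function X -> C. *)
Definition supn (f : X -> C) : R := sup (range (fun x => cabs (f x))).

(** A is a uniform algebra on X: X compact Hausdorff, A is a subalgebra of
    C(X) containing the constants, closed in C(X) for the supremum norm. *)
Definition uniform_algebra (A : set (X -> C)) : Prop :=
  [/\ compact [set: X], hausdorff_space X,
      (forall f, A f -> ccontinuous f),
      (forall c : C, A (fun _ => c)) &
    [/\ (forall (l : C) f g, A f -> A g -> A (fun x => l * f x + g x)),
      (forall f g, A f -> A g -> A (fun x => f x * g x)) &
      (forall f, ccontinuous f ->
         (forall e : R, 0 < e -> exists2 g, A g & supn (fun x => f x - g x) < e) ->
         A f)]].

Variable n : nat.

(** Euclidean norm on C^n and operator norm on M_n(C). *)
Definition vnorm (v : 'cV[C]_n) : R := Num.sqrt (\sum_(i < n) cabs (v i ord0) ^+ 2).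

Definition opnorm (M : 'M[C]_n) : R :=
  sup [set vnorm (M *m v) | v in [set v : 'cV[C]_n | vnorm v <= 1]].

(** Conjugate transpose. *)
Definition adjmx (M : 'M[C]_n) : 'M[C]_n := map_mx (fun z : C => z^*) M^T.

(** [T : A -> M_n(C)] has operator norm at most [c] (w.r.t. the sup norm). *)
Definition opnorm_le (A : set (X -> C)) (T : (X -> C) -> 'M[C]_n) (c : R) : Prop :=
  forall f, A f -> opnorm (T f) <= c * supn f.

(** Unital (complex-linear) algebra homomorphism A -> M_n(C). *)
Definition unital_hom (A : set (X -> C)) (theta : (X -> C) -> 'M[C]_n) : Prop :=
  [/\ (forall (l : C) f g, A f -> A g ->
         theta (fun x => l * f x + g x) = l *: theta f + theta g),
      (forall f g, A f -> A g -> theta (fun x => f x * g x) = theta f *m theta g) &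
      theta (fun _ => 1) = 1%:M].

(** Continuity of theta : (A, sup norm) -> (M_n(C), operator norm). *)
Definition hom_continuous (A : set (X -> C)) (theta : (X -> C) -> 'M[C]_n) : Prop :=
  forall f, A f -> forall e : R, 0 < e -> exists2 d : R, 0 < d &
    forall g, A g -> supn (fun x => g x - f x) < d -> opnorm (theta g - theta f) < e.

(** alpha : A -> A is an antilinear contraction. *)
Definition antilinear_contraction (A : set (X -> C)) (alpha : (X -> C) -> (X -> C)) : Prop :=
  [/\ (forall f, A f -> A (alpha f)),
      (forall (l : C) f g, A f -> A g ->
         alpha (fun x => l * f x + g x) = (fun x => l^* * alpha f x + alpha g x)) &
      (forall f, A f -> supn (alpha f) <= supn f)].

(** theta_alpha(f) = 1/2 (theta(f) + theta(alpha f)^* ). *)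
Definition theta_alpha (theta : (X -> C) -> 'M[C]_n) (alpha : (X -> C) -> (X -> C))
  (f : X -> C) : 'M[C]_n :=
  (2%:R : C)^-1 *: (theta f + adjmx (theta (alpha f))).

End UniformAlgebras.

(* Main.v *)
(** Write [T = theta f], [U = theta (alpha f)] and [K = ||theta||], finite by
    continuity.  Since [T^* = (T + U^* )^* - U] and [theta] is multiplicative,
    [T T^* T T^* = T (T + U^* )^* T T^* - theta (f * alpha f * f) T^*], where
    [f * alpha f * f] lies in the unit ball when [f] does.  By the C*-identity
    [||T||^4 <= 2 ||T||^3 + K ||T||]; taking suprema, [K^2 <= 2 K + 1].

    Equality is attained on the algebra [C^2] of functions on two points, with
    [theta g = [[g0, g0 - g1], [0, g1]]] and [alpha g = - conj g]: the diagonal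
    of [theta_alpha g] cancels, leaving [(g0 - g1) / 2] times a rotation, while
    [theta (1, -1)] has norm [1 + sqrt 2]. *)
Require Import Defs.
From HB Require Import structures.
From mathcomp Require Import all_boot all_order all_algebra.
From mathcomp Require Import complex.
From mathcomp Require Import all_classical all_reals all_analysis.
From mathcomp Require Import ring lra.
Import Order.TTheory GRing.Theory Num.Theory.
Local Open Scope ring_scope.
Local Open Scope classical_set_scope.

(** * Modulus and real part of complex numbers *)

Section Modulus.
Context {R : realType}.
Implicit Types z w : R[i].

(** Bridge to the library modulus, from which multiplicativity, the triangle inequality and
    definiteness are inherited. *)
Lemma cabsE z : cabs z = Normc.normc z.
Proof. by case: z. Qed.

Lemma cabs_ge0 z : 0 <= cabs z.
Proof. exact: sqrtr_ge0. Qed.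

Lemma cabsM z w : cabs (z * w) = cabs z * cabs w.
Proof. by rewrite !cabsE Normc.normcM. Qed.

Lemma cabsD z w : cabs (z + w) <= cabs z + cabs w.
Proof. by rewrite !cabsE le_normcD. Qed.

Lemma cabsN z : cabs (- z) = cabs z.
Proof. by rewrite /cabs !raddfN /= !sqrrN. Qed.

Lemma cabs_dist z w : `|cabs z - cabs w| <= cabs (w - z).
Proof.
have := cabsD (w - z) z; have := cabsD (z - w) w.
rewrite !subrK -[z - w]opprB cabsN => zw wz.
by rewrite ler_norml; apply/andP; split; lra.
Qed.

Lemma cabs_eq0 z : cabs z = 0 -> z = 0.
Proof. by rewrite cabsE => /Normc.eq0_normc. Qed.

Lemma cabs_real (x : R) : cabs x%:C%C = `|x|.
Proof. by rewrite /cabs /= expr0n /= addr0 sqrtr_sqr. Qed.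

Lemma conjE z : Num.conj z = conjc z.
Proof. by []. Qed.

Lemma cabsJ z : cabs (Num.conj z) = cabs z.
Proof. by rewrite conjE; case: z => a b; rewrite /cabs /= sqrrN. Qed.

Lemma cabs_sqr z : cabs z ^+ 2 = complex.Re (z * Num.conj z).
Proof.
rewrite conjE; case: z => a b; rewrite /cabs /= sqr_sqrtr ?addr_ge0 ?sqr_ge0 //.
by rewrite mulrN opprK.
Qed.

Lemma ReD z w : complex.Re (z + w) = complex.Re z + complex.Re w.
Proof. by case: z w => [a b] [c d]. Qed.

Lemma Re_sum (I : Type) (r : seq I) (P : pred I) (F : I -> R[i]) :
  complex.Re (\sum_(i <- r | P i) F i) = \sum_(i <- r | P i) complex.Re (F i).
Proof. exact: (big_morph _ ReD (erefl : complex.Re 0 = 0)). Qed.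

End Modulus.

(** * Euclidean geometry of complex column vectors *)

Section VectorNorm.
Context {R : realType} {n : nat}.
Implicit Types (u v : 'cV[R[i]]_n) (M N : 'M[R[i]]_n).

(** Real part of the Hermitian product, that is, the Euclidean product of the underlying real space
    of dimension [2n]. It determines [vnorm] and keeps all inequalities in [R]. *)
Definition rdot u v : R := complex.Re (\sum_i u i ord0 * Num.conj (v i ord0)).

Lemma vnorm_ge0 v : 0 <= vnorm v.
Proof. exact: sqrtr_ge0. Qed.

Lemma vnorm_sqr v : vnorm v ^+ 2 = \sum_i cabs (v i ord0) ^+ 2.
Proof. by rewrite sqr_sqrtr // sumr_ge0 // => i _; exact: sqr_ge0. Qed.

Lemma rdotE u v : rdot u v = \sum_i complex.Re (u i ord0 * Num.conj (v i ord0)).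
Proof. exact: Re_sum. Qed.

Lemma rdot_self v : rdot v v = vnorm v ^+ 2.
Proof. by rewrite rdotE vnorm_sqr; apply: eq_bigr => i _; rewrite cabs_sqr. Qed.

Lemma cabs_le_vnorm v i : cabs (v i ord0) <= vnorm v.
Proof.
rewrite -(@ler_pXn2r _ 2) ?nnegrE ?cabs_ge0 ?vnorm_ge0 // vnorm_sqr (bigD1 i) //=.
by rewrite lerDl sumr_ge0 // => j _; exact: sqr_ge0.
Qed.

Lemma vnorm_eq0 v : vnorm v = 0 -> v = 0.
Proof.
move=> v0; apply/matrixP => i j; rewrite ord1 mxE; apply: cabs_eq0.
by apply/eqP; rewrite eq_le cabs_ge0 andbT -v0 cabs_le_vnorm.
Qed.

Lemma vnormZ (z : R[i]) v : vnorm (z *: v) = cabs z * vnorm v.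
Proof.
apply/eqP; rewrite -(@eqrXn2 _ 2) ?mulr_ge0 ?vnorm_ge0 ?cabs_ge0 // exprMn !vnorm_sqr.
by rewrite mulr_sumr; apply/eqP; apply: eq_bigr => i _; rewrite mxE cabsM exprMn.
Qed.

Lemma vnorm0 : vnorm (0 : 'cV[R[i]]_n) = 0.
Proof. by rewrite -(scale0r 0) vnormZ (cabs_real 0) normr0 mul0r. Qed.

(** Coordinatewise expansion of the nonnegative square of the norm of [a u - b v]. The free weights
    allow Cauchy-Schwarz to be read off without normalising vectors. *)
Lemma rdot_amgm (a b : R) u v :
  a * b * rdot u v *+ 2 <= a ^+ 2 * vnorm u ^+ 2 + b ^+ 2 * vnorm v ^+ 2.
Proof.
rewrite rdotE !vnorm_sqr !mulr_sumr -sumrMnl -big_split; apply: ler_sum => i _ /=.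
rewrite !cabs_sqr !conjE; case: (u i _) (v i _) => [c d] [e f] /=.
rewrite -subr_ge0.
have -> : a ^+ 2 * (c * c - d * - d) + b ^+ 2 * (e * e - f * - f)
   - a * b * (c * e - d * - f) *+ 2 = (a * c - b * e) ^+ 2 + (a * d - b * f) ^+ 2.
  by ring.
by rewrite addr_ge0 ?sqr_ge0.
Qed.

Lemma rdot_le u v : rdot u v <= vnorm u * vnorm v.
Proof.
have [u0|uN0] := eqVneq (vnorm u) 0.
  rewrite u0 mul0r (vnorm_eq0 _ u0) rdotE big1 // => i _.
  by rewrite mxE mul0r.
have [v0|vN0] := eqVneq (vnorm v) 0.
  rewrite v0 mulr0 (vnorm_eq0 _ v0) rdotE big1 // => i _.
  by rewrite mxE rmorph0 mulr0.
(* With weights [a = vnorm v] and [b = vnorm u], both terms on the right of [rdot_amgm] become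
   equal; the common positive factor then cancels. *)
have uv_gt0 : 0 < vnorm v * vnorm u.
  by rewrite mulr_gt0 // lt_neqAle eq_sym ?uN0 ?vN0 vnorm_ge0.
rewrite -(ler_pM2l uv_gt0) -(@ler_pMn2r _ 2) //.
apply: (le_trans (rdot_amgm _ _ _ _)).
rewrite le_eqVlt; apply/orP; left; apply/eqP; ring.
Qed.

Lemma vnormD u v : vnorm (u + v) <= vnorm u + vnorm v.
Proof.
rewrite -(@ler_pXn2r _ 2) ?nnegrE ?addr_ge0 ?vnorm_ge0 //.
have -> : vnorm (u + v) ^+ 2 = vnorm u ^+ 2 + rdot u v *+ 2 + vnorm v ^+ 2.
  rewrite rdotE !vnorm_sqr -sumrMnl -!big_split; apply: eq_bigr => i _ /=.
  rewrite !cabs_sqr !conjE mxE; case: (u i _) (v i _) => [a b] [c d] /=; ring.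
by rewrite sqrrD lerD2r lerD2l ler_pMn2r // rdot_le.
Qed.

Lemma vnorm_sum (I : Type) (r : seq I) (P : pred I) (F : I -> 'cV[R[i]]_n) :
  vnorm (\sum_(i <- r | P i) F i) <= \sum_(i <- r | P i) vnorm (F i).
Proof.
apply: (big_ind2 (fun u a => vnorm u <= a)) => [|u a v b ua vb|//]; first by rewrite vnorm0.
exact: le_trans (vnormD _ _) (lerD ua vb).
Qed.

Lemma rdot_mulmx M u v : rdot (M *m u) v = rdot u (adjmx M *m v).
Proof.
rewrite /rdot; congr complex.Re.
under eq_bigr do rewrite mxE mulr_suml.
rewrite exchange_big; apply: eq_bigr => j _ /=.
rewrite mxE rmorph_sum mulr_sumr; apply: eq_bigr => i _.
by rewrite !mxE rmorphM /= conjCK [M i j * _]mulrC mulrA.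
Qed.

End VectorNorm.

(** * Operator norm, adjoints and the C*-identity *)

Section OperatorNorm.
Context {R : realType} {n : nat}.
Implicit Types (u v : 'cV[R[i]]_n) (M N T U : 'M[R[i]]_n).

(** A crude bound, obtained by writing the image as a combination of columns; it serves to show that
    the supremum defining [opnorm] is over a bounded set. *)
Lemma vnorm_mulmx_col M v : vnorm (M *m v) <= (\sum_j vnorm (col j M)) * vnorm v.
Proof.
have -> : M *m v = \sum_j v j ord0 *: col j M.
  apply/matrixP => i k; rewrite ord1 mxE summxE; apply: eq_bigr => j _.
  by rewrite !mxE mulrC.
apply: (le_trans (vnorm_sum _ _ _ _)); rewrite mulr_suml ler_sum // => j _.
by rewrite vnormZ mulrC ler_wpM2l ?vnorm_ge0 ?cabs_le_vnorm.
Qed.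

Lemma opnorm_has_ubound M :
  has_ubound [set vnorm (M *m v) | v in [set v : 'cV[R[i]]_n | vnorm v <= 1]].
Proof.
exists (\sum_j vnorm (col j M)) => _ [v /= v1 <-].
apply: (le_trans (vnorm_mulmx_col _ _)).
by rewrite ler_piMr // sumr_ge0 // => j _; exact: vnorm_ge0.
Qed.

Lemma opnorm_ge0 M : 0 <= opnorm M.
Proof.
rewrite /opnorm -[X in X <= _](@vnorm0 R n); apply: ub_le_sup.
  exact: opnorm_has_ubound.
by exists 0; rewrite ?mulmx0 //= vnorm0.
Qed.

Lemma vnorm_mulmx M v : vnorm (M *m v) <= opnorm M * vnorm v.
Proof.
have [v0|vN0] := eqVneq (vnorm v) 0.
  by rewrite (vnorm_eq0 _ v0) mulmx0 vnorm0 mulr0.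
have v_gt0 : 0 < vnorm v by rewrite lt_neqAle eq_sym vN0 vnorm_ge0.
have vV : cabs ((vnorm v)^-1)%:C%C = (vnorm v)^-1.
  by rewrite cabs_real gtr0_norm ?invr_gt0.
have : vnorm (M *m (((vnorm v)^-1)%:C%C *: v)) <= opnorm M.
  apply: ub_le_sup; first exact: opnorm_has_ubound.
  by eexists; last reflexivity; rewrite /= vnormZ vV mulVf.
by rewrite -scalemxAr vnormZ vV mulrC ler_pdivrMr.
Qed.

Lemma opnorm_le_bound M (c : R) :
  0 <= c -> (forall v, vnorm (M *m v) <= c * vnorm v) -> opnorm M <= c.
Proof.
move=> c0 Mc; apply: ge_sup.
  by exists (vnorm (M *m 0)); exists 0 => //=; rewrite vnorm0.
by move=> _ [v /= v1 <-]; apply: (le_trans (Mc v)); rewrite ler_piMr.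
Qed.

Lemma opnormD M N : opnorm (M + N) <= opnorm M + opnorm N.
Proof.
apply: opnorm_le_bound => [|v]; first by rewrite addr_ge0 ?opnorm_ge0.
rewrite mulmxDl mulrDl; apply: (le_trans (vnormD _ _)).
by rewrite lerD ?vnorm_mulmx.
Qed.

Lemma opnormZ (z : R[i]) M : opnorm (z *: M) <= cabs z * opnorm M.
Proof.
apply: opnorm_le_bound => [|v]; first by rewrite mulr_ge0 ?cabs_ge0 ?opnorm_ge0.
by rewrite -scalemxAl vnormZ -mulrA ler_wpM2l ?cabs_ge0 ?vnorm_mulmx.
Qed.

Lemma opnormN M : opnorm (- M) <= opnorm M.
Proof.
by rewrite -scaleN1r (le_trans (opnormZ _ _)) // cabsN (cabs_real 1) normr1 mul1r.
Qed.

Lemma opnormM M N : opnorm (M *m N) <= opnorm M * opnorm N.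
Proof.
apply: opnorm_le_bound => [|v]; first by rewrite mulr_ge0 ?opnorm_ge0.
rewrite -mulmxA (le_trans (vnorm_mulmx _ _)) // -mulrA.
by rewrite ler_wpM2l ?opnorm_ge0 ?vnorm_mulmx.
Qed.

Lemma adjmxK : involutive (@adjmx R n).
Proof. by move=> M; apply/matrixP => i j; rewrite !mxE conjCK. Qed.

Lemma adjmxM M N : adjmx (M *m N) = adjmx N *m adjmx M.
Proof.
apply/matrixP => i j; rewrite !mxE rmorph_sum; apply: eq_bigr => k _.
by rewrite !mxE rmorphM mulrC.
Qed.

Lemma adjmxD M N : adjmx (M + N) = adjmx M + adjmx N.
Proof. by apply/matrixP => i j; rewrite !mxE rmorphD. Qed.

(** For [x = adjmx M *m v], the squared norm of [x] equals [rdot (M *m x) v], which is at most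
    [opnorm M * vnorm x * vnorm v]; cancel [vnorm x]. *)
Lemma opnorm_adj M : opnorm (adjmx M) <= opnorm M.
Proof.
apply: opnorm_le_bound => [|v]; first exact: opnorm_ge0.
have [->|x0] := eqVneq (vnorm (adjmx M *m v)) 0.
  by rewrite mulr_ge0 ?opnorm_ge0 ?vnorm_ge0.
have x_gt0 : 0 < vnorm (adjmx M *m v) by rewrite lt_neqAle eq_sym x0 vnorm_ge0.
rewrite -(ler_pM2l x_gt0) -expr2 -rdot_self -rdot_mulmx.
apply: (le_trans (rdot_le _ _)); rewrite mulrA ler_wpM2r ?vnorm_ge0 //.
by rewrite mulrC vnorm_mulmx.
Qed.

(** One half of the C*-identity. The squared norm of [adjmx M *m v] is [rdot (M *m adjmx M *m v) v],
    so Cauchy-Schwarz bounds [opnorm (adjmx M)], and [opnorm_adj] transfers the bound to [M]. *)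
Lemma opnorm_sqr_le M : opnorm M ^+ 2 <= opnorm (M *m adjmx M).
Proof.
have C_ge0 := opnorm_ge0 (M *m adjmx M).
have Msqr : opnorm M <= Num.sqrt (opnorm (M *m adjmx M)).
  rewrite -{1}(adjmxK M) (le_trans (opnorm_adj _)) //.
  apply: opnorm_le_bound => [|v]; first exact: sqrtr_ge0.
  rewrite -(@ler_pXn2r _ 2) ?nnegrE ?mulr_ge0 ?sqrtr_ge0 ?vnorm_ge0 //.
  rewrite exprMn (sqr_sqrtr C_ge0) -rdot_self -rdot_mulmx.
  apply: (le_trans (rdot_le _ _)); rewrite expr2 mulrA.
  by rewrite ler_wpM2r ?vnorm_ge0 // mulmxA vnorm_mulmx.
by rewrite -(sqr_sqrtr C_ge0) ler_pXn2r ?nnegrE ?sqrtr_ge0 ?opnorm_ge0.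
Qed.

Lemma opnorm_quartic T U :
  opnorm T ^+ 4 <=
    opnorm (T + adjmx U) * opnorm T ^+ 3 + opnorm (T *m U *m T) * opnorm T.
Proof.
set S := T + adjmx U; set H := T *m adjmx T.
have Hadj : adjmx H = H by rewrite adjmxM adjmxK.
(* Only the first [adjmx T] in [H *m H] is replaced, by [adjmx S - U]. *)
have HE : H *m H = T *m adjmx S *m T *m adjmx T - (T *m U *m T) *m adjmx T.
  rewrite -mulmxBl -mulmxBl -mulmxBr /S adjmxD adjmxK addrK.
  by rewrite /H !mulmxA.
(* The C*-identity is applied twice: to [T], then to the self-adjoint [H]. *)
have HH : opnorm T ^+ 4 <= opnorm (H *m H).
  have := opnorm_sqr_le H; rewrite Hadj; apply: le_trans.
  have := opnorm_sqr_le T; rewrite -/H; have := opnorm_ge0 H.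
  move: (opnorm T) (opnorm H) => a b b_ge0 ab.
  by rewrite [a ^+ 4](exprM a 2 2) ler_pXn2r // nnegrE sqr_ge0.
have TS := le_trans (opnormM T (adjmx S)) (ler_wpM2l (opnorm_ge0 T) (opnorm_adj S)).
have TST := le_trans (opnormM _ T) (ler_wpM2r (opnorm_ge0 T) TS).
have TSTT := le_trans (opnormM _ (adjmx T))
  (ler_pM (opnorm_ge0 _) (opnorm_ge0 _) TST (opnorm_adj T)).
have TUTT := le_trans (opnormM (T *m U *m T) (adjmx T))
  (ler_wpM2l (opnorm_ge0 _) (opnorm_adj T)).
have := le_trans (opnormD _ _) (lerD TSTT (le_trans (opnormN _) TUTT)).
rewrite -HE => /(le_trans HH).
move: (opnorm T) (opnorm S) (opnorm (T *m U *m T)) => t s u.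
by have -> : t * s * t * t = s * t ^+ 3 by ring.
Qed.

End OperatorNorm.

(** * Supremum norm of bounded functions *)

Section SupNorm.
Context {R : realType} {X : topologicalType}.
Implicit Types f g : X -> R[i].

Lemma ccontinuous_bounded f : compact [set: X] -> ccontinuous f ->
  has_ubound (range (fun x => cabs (f x))).
Proof.
move=> cX cf; have cabsf : continuous (fun x => cabs (f x) : R^o).
  move=> x; apply/cvgrPdist_lt => e e0; near=> y.
  have fyx : cabs (f y - f x) < e by near: y; exact: cf.
  exact: le_lt_trans (cabs_dist _ _) fyx.
have := continuous_compact (continuous_subspaceT cabsf) cX.
move=> /compact_bounded /pinfty_ex_gt0[M _ fM].
by exists M => _ [x _ <-]; apply: le_trans (ler_norm _) (fM _ _); exists x.
Unshelve. all: by end_near. Qed.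

Lemma cabs_le_supn f x :
  has_ubound (range (fun x => cabs (f x))) -> cabs (f x) <= supn f.
Proof. by move=> fb; apply: ub_le_sup => //; exists x. Qed.

Lemma supn_ge0 f : has_ubound (range (fun x => cabs (f x))) -> 0 <= supn f.
Proof.
move=> fb; have [fx|/set0P[_ [x _ _]]] := eqVneq (range (fun x => cabs (f x))) set0.
  by rewrite /supn fx sup0.
exact: le_trans (cabs_ge0 (f x)) (cabs_le_supn _ _ fb).
Qed.

(* The bound must be nonnegative because [supn f = sup set0 = 0] when [X] is empty. *)
Lemma supn_le f (c : R) : 0 <= c -> (forall x, cabs (f x) <= c) -> supn f <= c.
Proof.
move=> c0 fc.
have [fx|/set0P fx] := eqVneq (range (fun x => cabs (f x))) set0.
  by rewrite /supn fx sup0.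
by apply: ge_sup => // _ [x _ <-].
Qed.

End SupNorm.

(* Ranging over all [t] in a set with supremum [K], this forces [K <= 1 + sqrt 2]. *)
Lemma quartic_defect (R : realType) (K t : R) :
  0 <= t -> t ^+ 4 <= 2 * t ^+ 3 + K * t -> 1 + Num.sqrt 2 <= K ->
  5 * t <= K + 4 * (1 + Num.sqrt 2).
Proof.
move=> t0 tK; have : Num.sqrt (2 : R) ^+ 2 = 2 by rewrite sqr_sqrtr.
have : 1 <= Num.sqrt (2 : R) by rewrite -[X in X <= _]sqrtr1 ler_wsqrtr ?ler1n.
(* If [t <= 1 + s], then [t <= K] as well, and the claim is the sum of [t <= K] and four copies of
   [t <= 1 + s]. *)
move: (Num.sqrt 2) => s s1 s2 Ks; have [ts|st] := leP t (1 + s); first by lra.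
have t_gt0 : 0 < t by lra.
have cubic : t ^+ 3 <= 2 * t ^+ 2 + K.
  rewrite -(ler_pM2l t_gt0).
  have -> : t * t ^+ 3 = t ^+ 4 by ring.
  by have -> : t * (2 * t ^+ 2 + K) = 2 * t ^+ 3 + K * t by ring.
have factor : t ^+ 3 - 2 * t ^+ 2 - t = t * (t - (1 - s)) * (t - (1 + s)).
  have -> : t * (t - (1 - s)) * (t - (1 + s)) =
    t * (t ^+ 2 - 2 * t + 1 - s ^+ 2) by ring.
  by rewrite s2; ring.
(* Since [s >= 1] and [t > 1 + s], both [t] and [t - (1 - s)] are at least 2, whence the factor 4.
   By [cubic] the right side is at most [K - t]. *)
have : 4 * (t - (1 + s)) <= t * (t - (1 - s)) * (t - (1 + s)).
  by rewrite ler_wpM2r //; nra.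
lra.
Qed.

(** * The upper bound for a homomorphism of a uniform algebra *)

Section UpperBound.
Context {R : realType} {X : topologicalType} {n : nat}.
Variables (A : set (X -> R[i])) (theta : (X -> R[i]) -> 'M[R[i]]_n).
Hypotheses (uA : uniform_algebra A) (hom : unital_hom A theta).

Lemma uniform_algebra_bounded f :
  A f -> has_ubound (range (fun x => cabs (f x))).
Proof. by case: uA => cX _ Ac _ _ Af; apply: ccontinuous_bounded => //; exact: Ac. Qed.

Lemma uniform_algebraZ (l : R[i]) f : A f -> A (fun x => l * f x).
Proof.
case: uA => _ _ _ Acst [Alin _ _] Af.
by have := Alin l _ _ Af (Acst 0); under eq_fun do rewrite addr0.
Qed.

Lemma hom0 : theta (fun=> 0) = 0.
Proof.
case: uA hom => _ _ _ Acst _ [lin _ _].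
have := lin (-1) _ _ (Acst 0) (Acst 0).
by rewrite scaleN1r addNr mulr0 addr0.
Qed.

Lemma homZ (l : R[i]) f : A f -> theta (fun x => l * f x) = l *: theta f.
Proof.
case: uA hom => _ _ _ Acst _ [lin _ _] Af.
have := lin l _ _ Af (Acst 0); rewrite hom0 addr0 => <-.
by congr theta; apply/funext => x; rewrite addr0.
Qed.

(** Its supremum plays the role of the norm of [theta], once the set is known to be bounded and
    nonempty. *)
Let unit_ball_image := [set opnorm (theta f) | f in [set f | A f /\ supn f <= 1]].

(** Continuity at 0 with tolerance 1 gives a radius [d]; scaling the unit ball by [d / 2] puts it
    strictly inside that radius, so [2 / d] is a bound. *)
Lemma hom_bounded : hom_continuous A theta -> has_ubound unit_ball_image.
Proof.
move=> cont; have A0 : A (fun=> 0) by case: uA.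
have [d d0 dP] := cont _ A0 1 ltr01.
exists (2 / d) => _ [f [Af f1] <-].
have half_gt0 : 0 < d / 2 by rewrite divr_gt0.
have two_gt0 : 0 < 2 / d by rewrite divr_gt0.
pose g x := (d / 2)%:C%C * f x.
have Ag : A g by exact: uniform_algebraZ.
have gd : supn (fun x => g x - 0) < d.
  apply: (@le_lt_trans _ _ (d / 2)); last by rewrite ltr_pdivrMr // ltr_pMr ?ltr1n.
  apply: supn_le => [|x]; first exact: ltW.
  rewrite subr0 cabsM cabs_real gtr0_norm // ler_piMr ?(ltW half_gt0) //.
  by apply: le_trans f1; apply: cabs_le_supn; exact: uniform_algebra_bounded.
have -> : theta f = (2 / d)%:C%C *: theta g.
  rewrite homZ // scalerA -rmorphM /= mulrA divfK ?gt_eqF //.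
  by rewrite divff ?pnatr_eq0 // scale1r.
apply: (le_trans (opnormZ _ _)); rewrite cabs_real gtr0_norm // ler_piMr ?(ltW two_gt0) //.
by have := dP _ Ag gd; rewrite hom0 subr0 => /ltW.
Qed.

Lemma hom_norm_le alpha : hom_continuous A theta ->
  antilinear_contraction A alpha -> opnorm_le A (theta_alpha theta alpha) 1 ->
  opnorm_le A theta (1 + Num.sqrt 2).
Proof.
move=> cont [Aalpha _ contr] theta1 f Af.
have bounded := hom_bounded cont.
set K := sup unit_ball_image.
have k_ge0 : 0 <= 1 + Num.sqrt 2 :> R by rewrite addr_ge0 ?sqrtr_ge0.
have le_K g : A g -> supn g <= 1 -> opnorm (theta g) <= K.
  by move=> Ag g1; apply: ub_le_sup => //; exists g.
have A0 : A (fun=> 0) by case: uA.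
have ball0 : unit_ball_image !=set0.
  exists (opnorm (theta (fun=> 0))), (fun=> 0) => //; split => //.
  by apply: supn_le => // x; rewrite (cabs_real 0) normr0.
have quartic g : A g -> supn g <= 1 ->
    opnorm (theta g) ^+ 4 <= 2 * opnorm (theta g) ^+ 3 + K * opnorm (theta g).
  move=> Ag g1; have Aag := Aalpha g Ag.
  have [_ _ _ _ [_ Amul _]] := uA; have [_ mul _] := hom.
  apply: (le_trans (opnorm_quartic _ (theta (alpha g)))); rewrite lerD //.
    rewrite ler_wpM2r ?exprn_ge0 ?opnorm_ge0 //.
    (* The coefficient 2 of the cubic term undoes the factor one half in [theta_alpha]. *)
    have -> : theta g + adjmx (theta (alpha g)) =
        2%:R%:C%C *: theta_alpha theta alpha g.
      by rewrite /theta_alpha scalerA rmorph_nat divff ?pnatr_eq0 // scale1r.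
    apply: (le_trans (opnormZ _ _)); rewrite cabs_real ger0_norm // ler_piMr //.
    by apply: le_trans (theta1 g Ag) _; rewrite mul1r.
  rewrite ler_wpM2r ?opnorm_ge0 // -!mul //; last exact: Amul.
  (* By multiplicativity the triple product is the image of [g * alpha g * g], which stays in the
     unit ball because [alpha] is a contraction. *)
  apply: le_K; first exact: Amul (Amul _ _ Ag Aag) Ag.
  have cabs_g x : cabs (g x) <= 1.
    by apply: le_trans g1; apply: cabs_le_supn; exact: uniform_algebra_bounded.
  apply: supn_le => // x; rewrite !cabsM.
  have cabs_ag : cabs (alpha g x) <= 1.
    apply: le_trans (le_trans (contr g Ag) g1).
    by apply: cabs_le_supn; exact: uniform_algebra_bounded.
  by rewrite mulr_ile1 ?mulr_ge0 ?cabs_ge0 // mulr_ile1 ?cabs_ge0.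
have K_le : K <= 1 + Num.sqrt 2.
  (* If [K] exceeded [1 + sqrt 2], [quartic_defect] would bound the whole set by a weighted mean of
     [K] and [1 + sqrt 2], strictly below its supremum [K]. *)
  rewrite leNgt; apply/negP => kK.
  suff : K <= (K + 4 * (1 + Num.sqrt 2)) / 5 by lra.
  apply: ge_sup => [|_ [g [Ag g1] <-]]; first exact: ball0.
  rewrite ler_pdivlMr // mulrC.
  by apply: quartic_defect; [exact: opnorm_ge0|exact: quartic|exact: ltW].
have fb := uniform_algebra_bounded _ Af.
(* The general case divides [f] by [supn f] to enter the unit ball, so a vanishing norm is treated
   apart. *)
have [s0|sN0] := eqVneq (supn f) 0.
  have -> : f = (fun=> 0).
    apply/funext => x; apply: cabs_eq0; apply/eqP.
    by rewrite eq_le cabs_ge0 andbT -s0 cabs_le_supn.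
  rewrite hom0 -(scale0r 0) (le_trans (opnormZ _ _)) // (cabs_real 0) normr0 mul0r.
  rewrite mulr_ge0 // supn_ge0 //; apply: uniform_algebra_bounded; exact: A0.
have s_gt0 : 0 < supn f by rewrite lt_neqAle eq_sym sN0 supn_ge0.
have Ag := uniform_algebraZ ((supn f)^-1)%:C%C _ Af.
have -> : theta f = (supn f)%:C%C *: theta (fun x => ((supn f)^-1)%:C%C * f x).
  by rewrite homZ // scalerA -rmorphM divff //= scale1r.
apply: (le_trans (opnormZ _ _)); rewrite cabs_real gtr0_norm // mulrC.
rewrite ler_wpM2r ?(ltW s_gt0) // (le_trans _ K_le) // le_K //.
apply: supn_le => // x; rewrite cabsM cabs_real gtr0_norm ?invr_gt0 //.
by rewrite mulrC ler_pdivrMr // mul1r cabs_le_supn.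
Qed.

End UpperBound.

(** * The extremal example on two points *)

Section Sharpness.
Context {R : realType}.
Local Notation C := R[i].

(** This is [g true *: P + g false *: (1 - P)] for the oblique idempotent [P] with rows [(1, 1)] and
    [(0, 0)], which is why it is multiplicative and unital. *)
Definition triangular_hom (g : bool -> C) : 'M[C]_2 :=
  \matrix_(i, j)
    if i == ord0 then if j == ord0 then g true else g true - g false
    else if j == ord0 then 0 else g false.

Definition neg_conj (g : bool -> C) : bool -> C := fun x => - Num.conj (g x).

Lemma ccontinuous_bool (g : bool -> C) : ccontinuous g.
Proof.
move=> x e e0; near=> y.
have -> : y = x by near: y; exact: discrete_set1.
by rewrite subrr (cabs_real 0) normr0.
Unshelve. all: by end_near. Qed.

Lemma bounded_bool (g : bool -> C) : has_ubound (range (fun x => cabs (g x))).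
Proof. exact: ccontinuous_bounded _ bool_compact (ccontinuous_bool g). Qed.

Lemma uniform_algebra_bool : uniform_algebra [set: bool -> C].
Proof.
split=> //; first exact: bool_compact.
- exact: discrete_hausdorff.
- by move=> f _; exact: ccontinuous_bool.
Qed.

Lemma matrix2P (M N : 'M[C]_2) :
  M ord0 ord0 = N ord0 ord0 -> M ord0 ord_max = N ord0 ord_max ->
  M ord_max ord0 = N ord_max ord0 -> M ord_max ord_max = N ord_max ord_max ->
  M = N.
Proof.
have ord2 (k : 'I_2) : k = ord0 \/ k = ord_max.
  by case: k => [[|[|//]] lt_k]; [left|right]; exact: val_inj.
move=> e00 e01 e10 e11; apply/matrixP => i j.
by case: (ord2 i) (ord2 j) => -> [->|->].
Qed.

Lemma sum_ord2 (V : nmodType) (F : 'I_2 -> V) :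
  \sum_i F i = F ord0 + F ord_max.
Proof. by rewrite big_ord_recr big_ord1; congr (F _ + _); exact: val_inj. Qed.

Lemma triangular_hom_lin (l : C) f g :
  triangular_hom (fun x => l * f x + g x) =
    l *: triangular_hom f + triangular_hom g.
Proof. by apply: matrix2P; rewrite !mxE /=; ring. Qed.

Lemma triangular_unital_hom : unital_hom [set: bool -> C] triangular_hom.
Proof.
split=> [l f g _ _|f g _ _|]; first exact: triangular_hom_lin.
  by apply: matrix2P; rewrite !mxE ?sum_ord2 ?mxE /=; ring.
by apply: matrix2P; rewrite !mxE //= subrr.
Qed.

(** A deliberately crude constant, used only for continuity. *)
Lemma triangular_hom_norm (g : bool -> C) : opnorm (triangular_hom g) <= 4 * supn g.
Proof.
have s_ge0 := supn_ge0 _ (bounded_bool g).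
have gs x : cabs (g x) <= supn g by apply: cabs_le_supn; exact: bounded_bool.
apply: opnorm_le_bound => [|v]; first by rewrite mulr_ge0.
rewrite -(@ler_pXn2r _ 2) ?nnegrE ?mulr_ge0 ?vnorm_ge0 //.
rewrite vnorm_sqr sum_ord2 ![(triangular_hom g *m v) _ _]mxE !sum_ord2 !mxE /=.
rewrite mul0r add0r.
have v_ge0 := vnorm_ge0 v.
have sv x k : cabs (g x * v k ord0) <= supn g * vnorm v.
  by rewrite cabsM ler_pM ?cabs_ge0 ?gs ?cabs_le_vnorm.
have sv_ge0 : 0 <= supn g * vnorm v by rewrite mulr_ge0.
have row0 : cabs (g true * v ord0 ord0 + (g true - g false) * v ord_max ord0)
    <= 3 * (supn g * vnorm v).
  apply: (le_trans (cabsD _ _)); rewrite mulrBl.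
  have := cabsD (g true * v ord_max ord0) (- (g false * v ord_max ord0)).
  rewrite cabsN; have := (sv true ord0, sv true ord_max, sv false ord_max).
  by move=> [[? ?] ?] ?; lra.
have row1 := sv false ord_max.
set m := supn g * vnorm v in row0 row1 sv_ge0.
(* The two coordinates are at most [3 * m] and [m], and [9 + 1 <= 16]. *)
apply: (@le_trans _ _ ((3 * m) ^+ 2 + m ^+ 2)).
  by rewrite lerD // ler_pXn2r ?nnegrE ?cabs_ge0 ?mulr_ge0.
have -> : 4 * supn g * vnorm v = 4 * m by rewrite /m mulrA.
by have := sqr_ge0 m; rewrite !exprMn; lra.
Qed.

Lemma triangular_hom_continuous : hom_continuous [set: bool -> C] triangular_hom.
Proof.
move=> f _ e e0; exists (e / 4) => [|g _]; first by rewrite divr_gt0.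
rewrite ltr_pdivlMr // mulrC; apply: le_lt_trans.
have -> : triangular_hom g - triangular_hom f = triangular_hom (fun x => g x - f x).
  by apply: matrix2P; rewrite !mxE /=; ring.
exact: triangular_hom_norm.
Qed.

Lemma neg_conj_contraction : antilinear_contraction [set: bool -> C] neg_conj.
Proof.
split=> // [l f g _ _|f _].
  by apply/funext => x; rewrite /neg_conj rmorphD rmorphM; ring.
by rewrite /supn /neg_conj; under eq_fun do rewrite cabsN cabsJ.
Qed.

Lemma theta_alpha_triangular (g : bool -> C) (v : 'cV[C]_2) :
  vnorm (theta_alpha triangular_hom neg_conj g *m v) =
    cabs (2%:R^-1 * (g true - g false)) * vnorm v.
Proof.
set d := 2%:R^-1 * _.
(* The adjoint of [triangular_hom (neg_conj g)] is minus the transpose of [triangular_hom g], so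
   [theta_alpha] yields the antisymmetric part, which scales every norm by the modulus of [d]. *)
have -> : theta_alpha triangular_hom neg_conj g = \matrix_(i, j)
    if i == ord0 then if j == ord0 then 0 else d
    else if j == ord0 then - d else 0.
  apply: matrix2P; rewrite !mxE /= /neg_conj ?(rmorphN, rmorphB, rmorph0) /=;
    by rewrite ?conjCK /d; ring.
apply/eqP; rewrite -(@eqrXn2 _ 2) ?mulr_ge0 ?vnorm_ge0 ?cabs_ge0 // exprMn.
rewrite !vnorm_sqr !sum_ord2 ![(_ *m v) _ _]mxE !sum_ord2 !mxE /=.
rewrite !mul0r add0r addr0 mulNr cabsN !cabsM !exprMn.
by rewrite mulrDr addrC.
Qed.

Lemma theta_alpha_triangular_norm :
  opnorm_le [set: bool -> C] (theta_alpha triangular_hom neg_conj) 1.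
Proof.
move=> g _; rewrite mul1r.
have s_ge0 := supn_ge0 _ (bounded_bool g).
have gs x : cabs (g x) <= supn g by apply: cabs_le_supn; exact: bounded_bool.
apply: opnorm_le_bound => // v; rewrite theta_alpha_triangular.
rewrite ler_wpM2r ?vnorm_ge0 // cabsM.
have -> : cabs (2%:R^-1 : C) = 2^-1.
  have -> : (2%:R^-1 : C) = (2^-1)%:C%C by rewrite fmorphV rmorph_nat.
  by rewrite cabs_real ger0_norm ?invr_ge0.
have := cabsD (g true) (- g false); rewrite cabsN.
by have := (gs true, gs false); move=> [? ?] ?; lra.
Qed.

(* The value [[1, 2], [0, -1]] at [(1, -1)] has singular values [sqrt 2 +- 1]; the vector
   [(1, 1 + sqrt 2)] is a top right singular vector. *)
Lemma triangular_hom_norm_ge (c : R) :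
  opnorm_le [set: bool -> C] triangular_hom c -> 1 + Num.sqrt 2 <= c.
Proof.
pose f (b : bool) : C := if b then 1 else -1.
pose s := 1 + Num.sqrt 2 : R.
have s_ge0 : 0 <= s by rewrite addr_ge0 ?sqrtr_ge0.
(* The equality case of the quadratic inequality behind the upper bound. *)
have s_sqr : s ^+ 2 = 2 * s + 1.
  rewrite /s; have : Num.sqrt (2 : R) ^+ 2 = 2 by rewrite sqr_sqrtr.
  by move: (Num.sqrt 2) => r r2; rewrite sqrrD r2; ring.
have cabs_f x : cabs (f x) = 1 by case: x; rewrite /f ?cabsN (cabs_real 1) normr1.
have f1 : supn f = 1.
  apply/eqP; rewrite eq_le supn_le // => [|x]; last by rewrite cabs_f.
  by rewrite -{1}(cabs_f true) cabs_le_supn //; exact: bounded_bool.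
move=> /(_ f I); rewrite f1 mulr1; apply: le_trans.
pose v : 'cV[C]_2 := \col_i if i == ord0 then 1 else s%:C%C.
have v_sqr : vnorm v ^+ 2 = 1 + s ^+ 2.
  by rewrite vnorm_sqr sum_ord2 !mxE /= (cabs_real 1) cabs_real normr1 expr1n real_normK ?num_real.
have v_gt0 : 0 < vnorm v.
  rewrite lt_neqAle vnorm_ge0 andbT eq_sym; apply/negP => /eqP v0.
  by move: v_sqr; rewrite v0; have := sqr_ge0 s; rewrite expr0n /=; lra.
rewrite -(ler_pM2r v_gt0); apply: le_trans (vnorm_mulmx _ _).
rewrite -(@ler_pXn2r _ 2) ?nnegrE ?mulr_ge0 ?vnorm_ge0 //.
rewrite exprMn v_sqr vnorm_sqr sum_ord2 ![(_ *m _) _ _]mxE !sum_ord2 !mxE /=.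
have -> : 1 * 1 + (1 - -1) * s%:C%C = (1 + (s + s))%:C%C :> C.
  by rewrite !rmorphD rmorph1; ring.
have -> : 0 * 1 + -1 * s%:C%C = (- s)%:C%C :> C by rewrite rmorphN; ring.
rewrite !cabs_real !real_normK ?num_real // sqrrN.
(* The image of [v] is thus [(s ^+ 2, - s)], whose squared norm is exactly
   [s ^+ 2 * (1 + s ^+ 2)]. *)
have -> : 1 + (s + s) = s ^+ 2 by rewrite s_sqr; ring.
by rewrite -/s le_eqVlt; apply/orP; left; apply/eqP; ring.
Qed.

End Sharpness.

Theorem theorem1p1 (R : realType) :
  (forall (X : topologicalType) (A : set (X -> R[i])) (n : nat)
     (theta : (X -> R[i]) -> 'M[R[i]]_n) (alpha : (X -> R[i]) -> (X -> R[i])),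
     uniform_algebra A -> unital_hom A theta -> hom_continuous A theta ->
     antilinear_contraction A alpha ->
     opnorm_le A (theta_alpha theta alpha) 1 ->
     opnorm_le A theta (1 + Num.sqrt 2))
  /\
  (forall c : R, c < 1 + Num.sqrt 2 ->
     exists (X : topologicalType) (A : set (X -> R[i])) (n : nat)
       (theta : (X -> R[i]) -> 'M[R[i]]_n) (alpha : (X -> R[i]) -> (X -> R[i])),
       uniform_algebra A /\ unital_hom A theta /\ hom_continuous A theta /\
       antilinear_contraction A alpha /\
       opnorm_le A (theta_alpha theta alpha) 1 /\
       ~ opnorm_le A theta c).
Proof.
split=> [X A n theta alpha uA hom cont contr|c c_lt].
  exact: hom_norm_le contr.
exists bool, setT, 2, triangular_hom, neg_conj.
split; first exact: uniform_algebra_bool.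
split; first exact: triangular_unital_hom.
split; first exact: triangular_hom_continuous.
split; first exact: neg_conj_contraction.
split; first exact: theta_alpha_triangular_norm.
by move=> /triangular_hom_norm_ge; rewrite leNgt c_lt.
Qed.
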